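(* Let $E, F$ be Riesz spaces and $T \in \mathcal{O}(E,F)$. If for every $x \in E$ the supremum $R(x) := \sup \{T(u) - T(v): \, x = u \sqcup v\}$ exists in $F$, then $|T|$ exists in $\mathcal{O}(E,F)$ and $|T| = R$. Moreover, in the case of existence (of the suprema $R(x)$ for all $x\in E$) the following hold. (1) If $T \in \mathcal{P}(E,F)$ then $|T| \in \mathcal{P}(E,F)$. (2) If $T \in \mathcal{U}(E,F)$ then $|T| \in \mathcal{U}(E,F)$.
   Context: A Riesz space is a real vector lattice (no Dedekind completeness or Archimedean property is assumed); $x \perp y$ (disjointness) means $|x| \wedge |y| = 0$. The notation $x = u \sqcup v$ means $x = u + v$ and $u \perp v$; the supremum is over all such pairs $u,v\in E$. An element $x$ is a fragment of $y$, written $x \sqsubseteq y$, if $x \perp y - x$; $\mathfrak{F}_e$ is the set of all fragments of $e$. A function $T \colon E \to F$ is an orthogonally additive operator (OAO) if $T(x+y) = T(x) + T(y)$ for all disjoint $x,y \in E$. $\mathcal{O}(E,F)$ is the vector space of all OAOs, ordered by $S \le T$ iff $S(x) \le T(x)$ for all $x \in E$; $|T| := T \vee (-T)$ is the least upper bound of $T$ and $-T$ in this ordered vector space. $\mathcal{P}(E,F)$ is the set of laterally-to-order bounded OAOs, i.e. those $T$ for which $T(\mathfrak{F}_e)$ is order bounded in $F$ for every $e \in E$. $\mathcal{U}(E,F)$ is the set of order bounded OAOs (abstract Uryson operators), i.e. those sending order bounded subsets of $E$ to order bounded subsets of $F$. *)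

(* Defs.v *)
From HB Require Import structures.
From mathcomp Require Import all_boot all_order all_algebra.
From mathcomp Require Import boolp classical_sets functions set_interval reals.

Set Implicit Arguments.
Unset Strict Implicit.
Unset Printing Implicit Defensive.

Import Order.TTheory GRing.Theory Num.Theory.
Local Open Scope classical_set_scope.
Local Open Scope ring_scope.

(* Partially ordered vector spaces in which any two elements have a least upper
   bound and a greatest lower bound; neither Dedekind completeness nor the
   Archimedean property is part of this structure. The lattice operations are
   fields here, and the Order.Lattice structure is derived just below, because
   HB cannot join Order.Lattice and GRing.Zmodule: Num.RealDomain already
   inherits from both, without an intermediate structure. *)
HB.mixin Record POrderedLmodule_isRiesz (R : realType) E
    of Num.POrderedZmodule E & GRing.Lmodule R E := {
  riesz_lerD2r : forall z x y : E, x <= y -> x + z <= y + z;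
  riesz_scaler_ge0 : forall (a : R) (x : E), 0 <= a -> 0 <= x -> 0 <= a *: x;
  riesz_meet : E -> E -> E;
  riesz_join : E -> E -> E;
  riesz_meetP : forall x y z : E,
    (x <= riesz_meet y z) = (x <= y) && (x <= z);
  riesz_joinP : forall x y z : E,
    (riesz_join x y <= z) = (x <= z) && (y <= z)
}.

#[short(type="rieszType")]
HB.structure Definition Riesz (R : realType) :=
  { E of Num.POrderedZmodule E & GRing.Lmodule R E
       & POrderedLmodule_isRiesz R E }.

HB.instance Definition _ (R : realType) (E : rieszType R) :=
  Order.POrder_MeetJoin_isLattice.Build ring_display (Riesz.sort E)
    (@riesz_meetP R E) (@riesz_joinP R E).

Section RieszDefs.
Context {R : realType} {E : rieszType R}.
Implicit Types x y u v e : E.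

Definition rabs x : E := (x `|` - x)%O.

Definition rdisjoint x y : Prop := (rabs x `&` rabs y)%O = 0.

Definition disjoint_sum x u v : Prop := x = u + v /\ rdisjoint u v.

Definition fragment x y : Prop := rdisjoint x (y - x).

Definition fragments e : set E := [set x | fragment x e].

Definition order_bounded (A : set E) : Prop :=
  exists a b : E, A `<=` [set x | a <= x <= b].

End RieszDefs.

Section OAO.
Context {R : realType} (E F : rieszType R).

Definition orthogonally_additive (T : E -> F) : Prop :=
  forall x y : E, rdisjoint x y -> T (x + y) = T x + T y.

Definition oao_pred : {pred E -> F} := [pred T | `[< orthogonally_additive T >]].

Record oao := OAO { oao_fun :> E -> F; oao_funP : oao_fun \in oao_pred }.

HB.instance Definition _ := [isSub of oao for oao_fun].
HB.instance Definition _ := [Choice of oao by <:].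

Lemma oao_submod_closed : submod_closed oao_pred.
Proof.
split; first by apply/asboolP => x y _; rewrite addr0.
move=> a f g /asboolP fP /asboolP gP; apply/asboolP => x y xy.
by rewrite /= !fctE /= fP // gP // scalerDr addrACA.
Qed.

HB.instance Definition _ :=
  GRing.isSubmodClosed.Build R (E -> F) oao_pred oao_submod_closed.

(* Both the vector space operations and the order are the pointwise ones,
   inherited from E -> F. *)
HB.instance Definition _ := [SubChoice_isSubLmodule of oao by <:].
HB.instance Definition _ :=
  [SubChoice_isSubPOrder of oao by <: with ring_display].

End OAO.

Notation "{ 'oao' E -> F }" := (oao E F)
  (at level 0, E at level 98, F at level 99, format "{ 'oao'  E  ->  F }").

Section OAOFacts.
Context {R : realType} {E F : rieszType R}.
Implicit Types S T : {oao E -> F}.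

Lemma oaoD T (x y : E) : rdisjoint x y -> T (x + y) = T x + T y.
Proof. by case: T => f fP; apply: (asboolP _ fP). Qed.

Lemma oao_leP S T : reflect (forall x, S x <= T x) (S <= T).
Proof. exact: lefP. Qed.

Lemma oaoNE T x : (- T) x = - T x.
Proof. by []. Qed.

End OAOFacts.

Section OAOClasses.
Context {R : realType} {E F : rieszType R}.
Implicit Type T : {oao E -> F}.

Definition is_modulus T (M : {oao E -> F}) : Prop := supremums [set T; - T] M.

Definition lateral_order_bounded : set {oao E -> F} :=
  [set T | forall e : E, order_bounded (T @` fragments e)].

Definition uryson : set {oao E -> F} :=
  [set T | forall A : set E, order_bounded A -> order_bounded (T @` A)].

Definition lateral_differences T (x : E) : set F :=
  [set w | exists u v : E, disjoint_sum x u v /\ w = T u - T v].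

End OAOClasses.

(* Main.v *)
(** If [x + y = u + v] with [x], [y] disjoint and [u], [v] disjoint, then the
    four parts [x^+ /\ u^+ - x^- /\ u^-], etc., form a common refinement of the
    two decompositions.  Hence, for disjoint [x] and [y], the set of
    differences [T u - T v] at [x + y] is the Minkowski sum of those at [x] and
    at [y], so its supremum is additive.  Boundedness holds because the parts
    of a disjoint sum [x] are fragments of every element of which [x] is a
    fragment, and have modulus at most [|x|]. *)
Require Import Defs.
From HB Require Import structures.
From mathcomp Require Import all_boot all_order all_algebra.
From mathcomp Require Import boolp classical_sets functions set_interval reals.

Set Implicit Arguments.
Unset Strict Implicit.
Unset Printing Implicit Defensive.

Import Order.TTheory GRing.Theory Num.Theory.
Local Open Scope classical_set_scope.
Local Open Scope ring_scope.

(** * Elementary Riesz space inequalities, moduli and disjointness *)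

Section RieszTheory.
Context {R : realType} {E : rieszType R}.
Implicit Types x y z t u v e p q c : E.

Lemma riesz_lerD x y z t : x <= y -> z <= t -> x + z <= y + t.
Proof.
move=> xy zt; apply: (le_trans (riesz_lerD2r z _ _ xy)).
by rewrite ![y + _]addrC; apply: riesz_lerD2r.
Qed.

Lemma riesz_lerBlDr x y z : (x - y <= z) = (x <= z + y).
Proof.
by apply/idP/idP => [/(riesz_lerD2r y)|/(riesz_lerD2r (- y))];
  rewrite ?subrK ?addrK.
Qed.

Lemma riesz_lerBrDr x y z : (x <= y - z) = (x + z <= y).
Proof. by rewrite -[in RHS](opprK z) riesz_lerBlDr. Qed.

Lemma riesz_lerN x y : x <= y -> - y <= - x.
Proof.
move=> xy; rewrite -[- y]add0r riesz_lerBlDr addrC -riesz_lerBlDr.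
by rewrite opprK add0r.
Qed.

Lemma riesz_addr_ge0 x y : 0 <= x -> 0 <= y -> 0 <= x + y.
Proof. by move=> x0 y0; rewrite -[0]addr0; apply: riesz_lerD. Qed.

Lemma rabs_leP x z : (rabs x <= z) = (x <= z) && (- x <= z).
Proof. exact: leUx. Qed.

Lemma ler_rabs x : x <= rabs x.
Proof. exact: leUl. Qed.

Lemma lerN_rabs x : - x <= rabs x.
Proof. exact: leUr. Qed.

Lemma rabsN x : rabs (- x) = rabs x.
Proof. by rewrite /rabs opprK joinC. Qed.

Lemma rabs_ge0 x : 0 <= rabs x.
Proof.
(* Adding [x <= rabs x] and [- x <= rabs x] bounds twice the modulus below by 0; scaling by 1/2 then
   concludes. *)
have h : 0 <= rabs x + rabs x.
  by rewrite -(subrr x); apply: riesz_lerD; rewrite ?ler_rabs ?lerN_rabs.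
have -> : rabs x = (2^-1 : R) *: (rabs x + rabs x).
  by rewrite -mulr2n -scaler_nat scalerA mulVf ?scale1r ?pnatr_eq0.
by apply: riesz_scaler_ge0 h; rewrite invr_ge0 ler0n.
Qed.

Lemma rabsD_le x y : rabs (x + y) <= rabs x + rabs y.
Proof.
by rewrite rabs_leP opprD !riesz_lerD ?ler_rabs ?lerN_rabs.
Qed.

Lemma riesz_meet_ge0 x y : 0 <= x -> 0 <= y -> (0 <= x `&` y)%O.
Proof. by rewrite lexI => -> ->. Qed.

Lemma riesz_meetD_le x y z : 0 <= x -> 0 <= y -> 0 <= z ->
  ((x + y) `&` z <= x `&` z + y `&` z)%O.
Proof.
move=> x0 y0 z0; set m := (_ `&` _)%O.
have mz : m <= z by apply: leIr.
have mzD t : 0 <= t -> m <= z + t.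
  by move=> t0; apply: (le_trans mz); rewrite -{1}[z]addr0 riesz_lerD.
rewrite -riesz_lerBlDr lexI !riesz_lerBlDr mzD ?riesz_meet_ge0 // andbT.
rewrite addrC -riesz_lerBlDr lexI !riesz_lerBlDr [y + x]addrC leIl /=.
exact: mzD.
Qed.

(** The element [x + y - z] is a lower bound of both [x] and [y], hence lies below their meet 0. *)
Lemma meet0_addr_le x y z : (x `&` y)%O = 0 -> x <= z -> y <= z -> x + y <= z.
Proof.
move=> xy0 xz yz; rewrite -[z]add0r -riesz_lerBlDr -xy0 lexI !riesz_lerBlDr.
by rewrite riesz_lerD //= addrC riesz_lerD.
Qed.

Lemma rdisjointC x y : rdisjoint x y -> rdisjoint y x.
Proof. by rewrite /rdisjoint meetC. Qed.

Lemma rdisjointW u v x y : rabs u <= rabs x -> rabs v <= rabs y ->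
  rdisjoint x y -> rdisjoint u v.
Proof.
move=> ux vy xy; apply: le_anti; rewrite riesz_meet_ge0 ?rabs_ge0 // andbT.
by rewrite -[X in _ <= X]xy; apply: leI2.
Qed.

Lemma rdisjointDl x y z : rdisjoint x z -> rdisjoint y z -> rdisjoint (x + y) z.
Proof.
move=> xz yz; apply: le_anti; rewrite riesz_meet_ge0 ?rabs_ge0 // andbT.
apply: (le_trans (leI2 (rabsD_le x y) (lexx _))).
by apply: (le_trans (riesz_meetD_le _ _ _)); rewrite ?rabs_ge0 // xz yz addr0.
Qed.

Lemma rdisjointNN x y : rdisjoint x y -> rdisjoint (- x) (- y).
Proof. by rewrite /rdisjoint !rabsN. Qed.

Lemma rabs0 : rabs (0 : E) = 0.
Proof. by rewrite /rabs oppr0 joinxx. Qed.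

Lemma rdisjoint0r x : rdisjoint x 0.
Proof. by rewrite /rdisjoint rabs0; apply/meet_r; apply: rabs_ge0. Qed.

(** Meet [|u| <= |u + v| + |v|] with [|u|]: the meet is subadditive, and disjointness kills the term
    [|v| /\ |u|]. *)
Lemma rabs_le_disjointD u v : rdisjoint u v -> rabs u <= rabs (u + v).
Proof.
move=> uv.
have h : rabs u <= rabs (u + v) + rabs v.
  by rewrite -[X in rabs X <= _](addrK v) -(rabsN v) rabsD_le.
rewrite -(meet_r h); apply: (le_trans (riesz_meetD_le _ _ _)); rewrite ?rabs_ge0 //.
by rewrite [X in _ + X]meetC uv addr0 leIl.
Qed.

(** * Positive parts and the common refinement of two disjoint sums *)

Definition rpos x : E := (x `|` 0)%O.

Lemma rpos_ge0 x : 0 <= rpos x.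
Proof. exact: leUr. Qed.

Lemma rpos_le_rabs x : rpos x <= rabs x.
Proof. by rewrite leUx ler_rabs rabs_ge0. Qed.

Lemma rposB x : rpos x - rpos (- x) = x.
Proof.
apply/eqP; rewrite subr_eq; apply/eqP/le_anti/andP; split.
  by rewrite leUx addrC -!riesz_lerBlDr subrr sub0r leUl leUr.
rewrite addrC -riesz_lerBrDr leUx !riesz_lerBrDr addNr add0r.
by rewrite leUl leUr.
Qed.

Lemma rpos_meet_disjoint x y : rdisjoint x y -> (rpos x `&` rpos y)%O = 0.
Proof.
move=> xy; apply: le_anti; rewrite riesz_meet_ge0 ?rpos_ge0 // andbT.
by rewrite -[X in _ <= X]xy leI2 ?rpos_le_rabs.
Qed.

Lemma rposD_disjoint_ge x y : rdisjoint x y -> rpos x <= rpos (x + y).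
Proof.
move=> xy.
have h : rpos x <= rpos (x + y) + rabs y.
  rewrite leUx riesz_addr_ge0 ?rpos_ge0 ?rabs_ge0 // andbT.
  by rewrite -[X in X <= _](addrK y) riesz_lerD ?leUl ?lerN_rabs.
rewrite -(meet_r h).
apply: (le_trans (riesz_meetD_le _ _ _)); rewrite ?rpos_ge0 ?rabs_ge0 //.
rewrite -[X in _ <= X]addr0 riesz_lerD ?leIl //.
by rewrite meetC -[X in _ <= X]xy leI2 ?rpos_le_rabs.
Qed.

Lemma rposD_le x y : rpos (x + y) <= rpos x + rpos y.
Proof. by rewrite leUx riesz_addr_ge0 ?rpos_ge0 // riesz_lerD ?leUl. Qed.

(** As [rpos (- x)] is the negative part of [x], this is the piece shared by [x] and [u]; its
    symmetry in the two lets one splitting lemma serve both decompositions. *)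
Definition common_part x u : E :=
  (rpos x `&` rpos u)%O - (rpos (- x) `&` rpos (- u))%O.

Lemma common_partC x u : common_part x u = common_part u x.
Proof. by rewrite /common_part meetC [(rpos (- x) `&` _)%O]meetC. Qed.

Lemma rabs_common_part x u : rabs (common_part x u) <= rabs x.
Proof.
(* Both the common part and its opposite are differences of nonnegative elements, so each lies below
   its first term. *)
have subl p q : 0 <= q -> p - q <= p.
  by move=> q0; rewrite riesz_lerBlDr -{1}[p]addr0 riesz_lerD.
rewrite rabs_leP opprB; apply/andP; split.
  apply: (le_trans (subl _ _ _)); first by rewrite riesz_meet_ge0 ?rpos_ge0.
  exact: le_trans (leIl _ _) (rpos_le_rabs _).
apply: (le_trans (subl _ _ _)); first by rewrite riesz_meet_ge0 ?rpos_ge0.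
by rewrite -(rabsN x); apply: le_trans (leIl _ _) (rpos_le_rabs _).
Qed.

Lemma rabs_common_partr x u : rabs (common_part x u) <= rabs u.
Proof. by rewrite common_partC rabs_common_part. Qed.

(** For [<=], meet [x^+ <= (x + y)^+ = (u + v)^+ <= u^+ + v^+] with [x^+]. For [>=], the two
    summands have meet 0 and both lie below [x^+]. *)
Lemma rpos_split x y u v : rdisjoint x y -> rdisjoint u v -> x + y = u + v ->
  rpos x = (rpos x `&` rpos u + rpos x `&` rpos v)%O.
Proof.
move=> xy uv e; apply/le_anti/andP; split.
  have h : rpos x <= rpos u + rpos v.
    by apply: le_trans (rposD_le _ _); rewrite -e; apply: rposD_disjoint_ge.
  rewrite -{1}(meet_r h) ![(rpos x `&` _)%O]meetC.
  by apply: riesz_meetD_le; rewrite ?rpos_ge0.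
apply: meet0_addr_le; rewrite ?leIl //; apply: le_anti.
rewrite -{1}(rpos_meet_disjoint uv) leI2 ?leIr //=.
by rewrite !riesz_meet_ge0 ?rpos_ge0.
Qed.

Lemma common_part_split x y u v :
  rdisjoint x y -> rdisjoint u v -> x + y = u + v ->
  x = common_part x u + common_part x v.
Proof.
move=> xy uv e; rewrite /common_part addrACA -opprD.
rewrite -(rpos_split xy uv e) -[LHS]rposB; congr (_ - _).
(* Negating both decompositions gives the same splitting for negative parts. *)
by apply: rpos_split; [exact: rdisjointNN xy|exact: rdisjointNN uv|
  rewrite -!opprD e].
Qed.

Lemma disjoint_sum_refine x y u v :
  rdisjoint x y -> rdisjoint u v -> x + y = u + v ->
  exists u1 u2 v1 v2, [/\ disjoint_sum x u1 v1, disjoint_sum y u2 v2,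
    disjoint_sum u u1 u2 & disjoint_sum v v1 v2].
Proof.
move=> xy uv e.
exists (common_part x u), (common_part y u), (common_part x v), (common_part y v).
have yx := rdisjointC xy; have vu := rdisjointC uv.
split; split.
- exact: common_part_split e.
- by apply: rdisjointW uv; apply: rabs_common_partr.
- by apply: (common_part_split yx uv); rewrite addrC.
- by apply: rdisjointW uv; apply: rabs_common_partr.
- rewrite ![common_part _ u]common_partC.
  by apply: (common_part_split uv xy).
- by apply: rdisjointW xy; apply: rabs_common_part.
- rewrite ![common_part _ v]common_partC.
  by apply: (common_part_split vu xy); rewrite addrC.
- by apply: rdisjointW xy; apply: rabs_common_part.
Qed.

Lemma disjoint_sumC x u v : disjoint_sum x u v -> disjoint_sum x v u.
Proof. by move=> [-> uv]; split; [exact: addrC|exact: rdisjointC]. Qed.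

Lemma disjoint_sumx0 x : disjoint_sum x x 0.
Proof. by split; [rewrite addr0|exact: rdisjoint0r]. Qed.

(** Converse to the refinement: decompositions of disjoint elements are glued. The cross pairs are
    disjoint because their members are dominated by [x] and [y]. *)
Lemma disjoint_sumD x y u1 v1 u2 v2 : rdisjoint x y ->
  disjoint_sum x u1 v1 -> disjoint_sum y u2 v2 ->
  [/\ disjoint_sum (x + y) (u1 + u2) (v1 + v2), rdisjoint u1 u2 & rdisjoint v1 v2].
Proof.
move=> xy [xE uv1] [yE uv2].
have u1x : rabs u1 <= rabs x by rewrite xE rabs_le_disjointD.
have v1x : rabs v1 <= rabs x.
  by rewrite xE addrC rabs_le_disjointD //; apply: rdisjointC.
have u2y : rabs u2 <= rabs y by rewrite yE rabs_le_disjointD.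
have v2y : rabs v2 <= rabs y.
  by rewrite yE addrC rabs_le_disjointD //; apply: rdisjointC.
split; [split|exact: rdisjointW xy|exact: rdisjointW xy].
  by rewrite xE yE addrACA.
apply: rdisjointDl; apply/rdisjointC/rdisjointDl.
- exact: rdisjointC.
- by apply: rdisjointC; apply: rdisjointW xy.
- by apply: rdisjointW xy.
- exact: rdisjointC.
Qed.

Lemma fragment_disjoint_suml x u v e :
  disjoint_sum x u v -> fragment x e -> fragment u e.
Proof.
move=> [xE uv] xe; rewrite /fragment.
(* Both summands are disjoint from [u]: the first since [|u| <= |x|], the second by assumption. *)
have -> : e - u = (e - x) + v by rewrite xE opprD addrA subrK.
apply/rdisjointC/rdisjointDl; last exact: rdisjointC.
by apply/rdisjointC; apply: rdisjointW xe; rewrite // xE rabs_le_disjointD.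
Qed.

End RieszTheory.

(** * The pointwise supremum as modulus, and its boundedness *)

Section Modulus.
Context {R : realType} {E F : rieszType R}.
Implicit Types (T S : {oao E -> F}) (x y u v : E) (w : F).

Lemma oao0 T : T 0 = 0.
Proof.
have /esym := oaoD T (rdisjoint0r (0 : E)).
by rewrite addr0 => /(congr1 (fun w => w - T 0)); rewrite addrK subrr.
Qed.

Lemma lateral_differencesP T x u v :
  disjoint_sum x u v -> lateral_differences T x (T u - T v).
Proof. by move=> xuv; exists u, v. Qed.

(** [supremum] takes the default [w] on the empty set and when no least upper bound exists; the
    hypotheses exclude these two cases. *)
Lemma supremums_supremum w (A : set F) :
  A !=set0 -> supremums A !=set0 -> supremums A (supremum w A).
Proof.
move=> A0 [s sA]; rewrite /supremum; case: ifPn => [/eqP A_|_].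
  by case: A0 => a; rewrite A_.
by case: xgetP => [_ -> //|/(_ s)].
Qed.

Variable T : {oao E -> F}.
Hypothesis hR : forall x, supremums (lateral_differences T x) !=set0.

Definition lateral_sup x : F := supremum 0 (lateral_differences T x).

Lemma lateral_sup_supremums x :
  supremums (lateral_differences T x) (lateral_sup x).
Proof.
apply: supremums_supremum => //.
by exists (T x - T 0); apply/lateral_differencesP/disjoint_sumx0.
Qed.

Lemma lateral_sup_ge x u v : disjoint_sum x u v -> T u - T v <= lateral_sup x.
Proof.
move=> xuv; have [ub _] := lateral_sup_supremums x.
exact: ub (lateral_differencesP T xuv).
Qed.

Lemma lateral_sup_le x w :
  (forall u v, disjoint_sum x u v -> T u - T v <= w) -> lateral_sup x <= w.
Proof.
move=> h; have [_ lub] := lateral_sup_supremums x.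
by apply: lub => _ [u [v [xuv ->]]]; apply: h.
Qed.

Lemma le_lateral_sup x : T x <= lateral_sup x.
Proof. by rewrite -[T x]subr0 -(oao0 T); apply/lateral_sup_ge/disjoint_sumx0. Qed.

Lemma leN_lateral_sup x : - T x <= lateral_sup x.
Proof.
rewrite -[- T x]add0r -(oao0 T).
by apply/lateral_sup_ge/disjoint_sumC/disjoint_sumx0.
Qed.

Lemma lateral_sup_oao : orthogonally_additive lateral_sup.
Proof.
move=> x y xy; apply/le_anti/andP; split.
  (* Refining a decomposition of [x + y] splits its difference into one at [x] plus one at [y]. *)
  apply: lateral_sup_le => u v [uvE uv].
  have [u1 [u2 [v1 [v2 [xs ys [-> u12] [-> v12]]]]]] :=
    disjoint_sum_refine xy uv uvE.
  by rewrite !oaoD // opprD addrACA riesz_lerD // lateral_sup_ge.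
(* The two suprema are handled in turn, moving the other one across the inequality; glued
   decompositions then give the bound. *)
rewrite -riesz_lerBrDr; apply: lateral_sup_le => u1 v1 xs.
rewrite riesz_lerBrDr addrC -riesz_lerBrDr; apply: lateral_sup_le => u2 v2 ys.
rewrite riesz_lerBrDr addrC.
have [xys u12 v12] := disjoint_sumD xy xs ys.
by have := lateral_sup_ge xys; rewrite !oaoD // opprD addrACA.
Qed.

Definition lateral_sup_map : {oao E -> F} := OAO (asboolT lateral_sup_oao).

Lemma lateral_sup_is_modulus : is_modulus T lateral_sup_map.
Proof.
split=> [_ [->|->]|S ubS].
- by apply/oao_leP => x; apply: le_lateral_sup.
- by apply/oao_leP => x; apply: leN_lateral_sup.
have /oao_leP TS : T <= S by apply: ubS; left.
have /oao_leP NTS : - T <= S by apply: ubS; right.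
(* Leastness: [T u - T v <= S u + S v = S (u + v)]. *)
apply/oao_leP => x; apply: lateral_sup_le => u v [-> uv].
by rewrite (oaoD S uv); apply: riesz_lerD (TS u) (NTS v).
Qed.

(** Shared by both boundedness claims: if [T] maps [B] into [[a, b]], then [a <= T x] and each
    [T u - T v] is at most [b - a]. *)
Lemma order_bounded_lateral_sup (A B : set E) :
  (forall x u v, A x -> disjoint_sum x u v -> B u) ->
  order_bounded (T @` B) -> order_bounded (lateral_sup @` A).
Proof.
move=> AB [a [b TB]]; exists a, (b - a) => _ [x Ax <-] /=.
have TP z : B z -> a <= T z /\ T z <= b.
  by move=> Bz; apply/andP; apply: (TB (T z)); exists z.
apply/andP; split.
  apply: le_trans (le_lateral_sup x).
  by have [] := TP _ (AB _ _ _ Ax (disjoint_sumx0 x)).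
apply: lateral_sup_le => u v xuv.
have [_ ub] := TP _ (AB _ _ _ Ax xuv).
have [va _] := TP _ (AB _ _ _ Ax (disjoint_sumC xuv)).
exact: riesz_lerD ub (riesz_lerN va).
Qed.

Lemma lateral_sup_lateral_order_bounded :
  lateral_order_bounded T -> lateral_order_bounded lateral_sup_map.
Proof.
move=> TP e; apply: order_bounded_lateral_sup (TP e) => x u v xe xuv.
exact: fragment_disjoint_suml xuv xe.
Qed.

Lemma lateral_sup_uryson : uryson T -> uryson lateral_sup_map.
Proof.
move=> TU A [a [b Aab]].
(* Every [x] in [[a, b]] has [|x| <= c], so the parts of its disjoint sums, whose moduli are at most
   [|x|], stay in [[- c, c]]. *)
pose c := (rabs a `|` rabs b)%O.
apply: (@order_bounded_lateral_sup _ [set z | - c <= z <= c]); last first.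
  by apply: TU; exists (- c), c.
move=> x u v Ax [xE uv].
have /andP[ax xb] := Aab _ Ax.
have uc : rabs u <= c.
  apply: (le_trans (rabs_le_disjointD uv)); rewrite -xE rabs_leP.
  apply/andP; split.
    exact: le_trans xb (le_trans (ler_rabs b) (leUr _ _)).
  exact: le_trans (riesz_lerN ax) (le_trans (lerN_rabs a) (leUl _ _)).
apply/andP; split; last exact: le_trans (ler_rabs u) uc.
rewrite -[u]opprK; apply: riesz_lerN.
exact: le_trans (lerN_rabs u) uc.
Qed.

End Modulus.

Theorem corollary3p6 (R : realType) (E F : rieszType R) (T : {oao E -> F})
    (hR : forall x : E, supremums (lateral_differences T x) !=set0) :
  exists M : {oao E -> F},
    [/\ is_modulus T M,
        forall x : E, M x = supremum 0 (lateral_differences T x),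
        lateral_order_bounded T -> lateral_order_bounded M &
        uryson T -> uryson M].
Proof.
exists (lateral_sup_map hR); split => //.
- exact: lateral_sup_is_modulus.
- exact: lateral_sup_lateral_order_bounded.
- exact: lateral_sup_uryson.
Qed.
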